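(* Every regular model set in an amenable locally compact group $G$ is right-uniformly mean almost periodic.
   Context: A cut-and-project scheme $(G,H,\mathcal L)$ consists of unimodular locally compact groups $G,H$ and a uniform lattice $\mathcal L$ (countable discrete cocompact subgroup) in $G\times H$ with $\pi^G|_{\mathcal L}$ injective and $\pi^H(\mathcal L)$ dense in $H$. For relatively compact $W\subseteq H$, $\Lambda_W=\pi^G(\mathcal L\cap(G\times W))$; it is a regular model set if moreover $W$ has nonempty interior and $m_H(\partial W)=0$, where $\partial W=\overline W\cap\overline{H\setminus W}$ and $m_H$ is a Haar measure on $H$. $G$ is amenable if it admits a left-invariant mean on $L^\infty(G)$. A set $T\subseteq G$ is right-relatively dense if $KT=G$ for some compact $K$, and left-relatively dense if $TK=G$ for some compact $K$. For a set $\Lambda\subseteq G$ identify $\Lambda$ with the counting measure $\delta_\Lambda(A)=\mathrm{card}(\Lambda\cap A)$; with $m$ a Haar measure on $G$, $\mathcal K$ the nonempty compact subsets of $G$ and $\mathcal K_p$ those of positive measure, the upper Leptin density is $\mathrm{L}^+_\Lambda=\inf_{K\in\mathcal K}\sup_{A\in\mathcal K_p}\delta_\Lambda(A)/m(KA)$. A model set $\Lambda$ in $G$ is right-uniformly mean almost periodic if for every $\varepsilon>0$ there is a set $T\subseteq G$ that is both left- and right-relatively dense such that $\mathrm{L}^+_{\Lambda\,\triangle\,(\Lambda t)}\le\varepsilon$ for every $t\in T$ ($\triangle$ = symmetric difference). *)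

(* Defs.v *)
From HB Require Import structures.
From mathcomp Require Import all_boot all_order all_algebra.
From mathcomp Require Import all_classical all_reals all_analysis.
Set Implicit Arguments. Unset Strict Implicit. Unset Printing Implicit Defensive.
Import Order.TTheory GRing.Theory Num.Theory numFieldTopology.Exports numFieldNormedType.Exports.
Local Open Scope classical_set_scope.
Local Open Scope ring_scope.

Record lcgroup := LCGroup {
  lcg_sort :> topologicalType;
  lcg_mul : lcg_sort -> lcg_sort -> lcg_sort;
  lcg_inv : lcg_sort -> lcg_sort;
  lcg_one : lcg_sort;
  lcg_mulA : forall x y z, lcg_mul x (lcg_mul y z) = lcg_mul (lcg_mul x y) z;
  lcg_mul1g : forall x, lcg_mul lcg_one x = x;
  lcg_mulg1 : forall x, lcg_mul x lcg_one = x;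
  lcg_mulVg : forall x, lcg_mul (lcg_inv x) x = lcg_one;
  lcg_mulgV : forall x, lcg_mul x (lcg_inv x) = lcg_one;
  lcg_cont : continuous (fun p : lcg_sort * lcg_sort => lcg_mul p.1 (lcg_inv p.2));
  lcg_hausdorff : hausdorff_space lcg_sort;
  lcg_loc_compact : forall x : lcg_sort, exists K : set lcg_sort, nbhs x K /\ compact K
}.
Arguments lcg_mul {G} : rename.
Arguments lcg_inv {G} : rename.
Arguments lcg_one {G} : rename.

Section Defs.
Variable R : realType.
Local Open Scope ereal_scope.

Definition Borel (T : topologicalType) (A : set T) : Prop := <<s [set U | open U] >> A.

Definition left_haar (G : lcgroup) (mu : set G -> \bar R) : Prop :=
    mu set0 = 0 /\
      (forall A, Borel A -> 0 <= mu A) /\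
      (forall F : nat -> set G, (forall n, Borel (F n)) -> trivIset setT F ->
          (fun n => \sum_(k < n) mu (F k)) @ \oo --> mu (\bigcup_n F n)) /\
      (forall (g : G) A, Borel A -> mu [set lcg_mul g a | a in A] = mu A) /\
      (forall K : set G, compact K -> mu K < +oo) /\
      (forall U : set G, open U -> U !=set0 -> 0 < mu U) /\
      (forall A : set G, Borel A ->
          mu A = ereal_inf [set mu U | U in [set U : set G | open U /\ A `<=` U]]) /\
    (forall U : set G, open U ->
          mu U = ereal_sup [set mu K | K in [set K : set G | compact K /\ K `<=` U]]).

Definition unimodular_haar (G : lcgroup) (mu : set G -> \bar R) : Prop :=
  left_haar mu /\
  (forall (g : G) A, Borel A -> mu [set lcg_mul a g | a in A] = mu A).

Definition null_set (G : lcgroup) (mu : set G -> \bar R) (N : set G) : Prop :=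
  exists B, [/\ Borel B, N `<=` B & mu B = 0].

Definition bounded_borel_fun (G : lcgroup) (f : G -> R) : Prop :=
  (forall U : set R, open U -> Borel (f @^-1` U)) /\
  (exists C : R, forall x, (`|f x| <= C)%R).

(* amenability: a left-invariant mean on L^oo(G, mu), i.e. a normalized positive
   linear functional on bounded Borel functions, which only depends on the
   mu-a.e. class of the function, and is invariant under left translations *)
Definition amenable (G : lcgroup) (mu : set G -> \bar R) : Prop :=
  exists M : (G -> R) -> R,
  [/\ (forall (a b : R) f g, bounded_borel_fun f -> bounded_borel_fun g ->
          M (fun x => a * f x + b * g x)%R = (a * M f + b * M g)%R),
      (forall f, bounded_borel_fun f -> (forall x, (0 <= f x)%R) -> (0 <= M f)%R),
      M (fun _ => 1%R) = 1%R,
      (forall f g, bounded_borel_fun f -> bounded_borel_fun g ->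
          null_set mu [set x | f x <> g x] -> M f = M g)
    & (forall f (s : G), bounded_borel_fun f ->
          M (fun x => f (lcg_mul s x)) = M f)].

Definition pmul (G H : lcgroup) (p q : G * H) : G * H :=
  (lcg_mul p.1 q.1, lcg_mul p.2 q.2).
Definition pinv (G H : lcgroup) (p : G * H) : G * H := (lcg_inv p.1, lcg_inv p.2).
Definition pone (G H : lcgroup) : G * H := (lcg_one, lcg_one).

Definition uniform_lattice (G H : lcgroup) (L : set (G * H)) : Prop :=
  [/\ [/\ L (pone G H),
          (forall p q, L p -> L q -> L (pmul p q)) &
          (forall p, L p -> L (pinv p))],
      countable L,
      (forall p, L p -> exists U : set (G * H), nbhs p U /\ U `&` L = [set p])
    & exists K : set (G * H), compact K /\
        (forall z, exists k l, [/\ K k, L l & z = pmul k l])].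

Definition cut_and_project (G H : lcgroup) (mG : set G -> \bar R)
    (mH : set H -> \bar R) (L : set (G * H)) : Prop :=
  [/\ unimodular_haar mG, unimodular_haar mH, uniform_lattice L,
      {in L &, injective (fun p : G * H => p.1)}
    & dense [set p.2 | p in L]].

Definition model_set (G H : lcgroup) (L : set (G * H)) (W : set H) : set G :=
  [set p.1 | p in L `&` [set p | W p.2]].

Definition topboundary (T : topologicalType) (W : set T) : set T :=
  closure W `&` closure (~` W).

Definition regular_window (H : lcgroup) (mH : set H -> \bar R) (W : set H) : Prop :=
  [/\ compact (closure W), interior W !=set0 & mH (topboundary W) = 0].

Definition setmul (G : lcgroup) (A B : set G) : set G :=
  [set lcg_mul a b | a in A & b in B].

Definition upper_leptin (G : lcgroup) (m : set G -> \bar R) (Lam : set G) : \bar R :=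
  ereal_inf [set ereal_sup [set counting (Lam `&` A) / m (setmul K A)
                           | A in [set A : set G | compact A /\ A !=set0 /\ 0 < m A]]
            | K in [set K : set G | compact K /\ K !=set0]].

Definition right_rel_dense (G : lcgroup) (T : set G) : Prop :=
  exists K : set G, compact K /\ setmul K T = setT.
Definition left_rel_dense (G : lcgroup) (T : set G) : Prop :=
  exists K : set G, compact K /\ setmul T K = setT.

Definition symdiff (T : Type) (A B : set T) : set T := (A `\` B) `|` (B `\` A).

Definition right_umap (G : lcgroup) (m : set G -> \bar R) (Lam : set G) : Prop :=
  forall eps : R, (0 < eps)%R ->
    exists T : set G, [/\ left_rel_dense T, right_rel_dense T &
      forall t, T t ->
        upper_leptin m (symdiff Lam [set lcg_mul x t | x in Lam]) <= eps%:E].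

End Defs.

(* Main.v *)
(* A direct packing argument: right translation by [t] moves [Lam_W] to
   [Lam_(W t')], where [t'] is the point of [H] paired with [t], so the symmetric
   difference is [Lam_O] with [O] close to the null boundary of [W] when [t'] is
   near [1]; such [t] form the relatively dense set [Lam_U]. It remains to bound
   the upper Leptin density of [Lam_O] by a constant times the Haar measure of a
   neighbourhood [O'] of [O]. Left translates of [Lam_O] by finitely many weighted
   lattice points, chosen so that their [H]-components discretise the Haar measure
   of a fixed compact set, all lie in one model set [Lam_B] and cover each point
   of [Lam_B] with total weight at most [mH O']. Since [Lam_B] is uniformly
   discrete, its points in a compact set are counted by the Haar measure of a
   thickening. *)
Require Import Defs.
From HB Require Import structures.
From mathcomp Require Import all_boot all_order all_algebra.
From mathcomp Require Import all_classical all_reals all_analysis.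
Set Implicit Arguments. Unset Strict Implicit. Unset Printing Implicit Defensive.
Import Order.TTheory GRing.Theory Num.Theory.
Local Open Scope classical_set_scope.
Local Open Scope ring_scope.

Local Notation "x *g y" := (lcg_mul x y) (at level 40, left associativity).
Local Notation "x ^-g" := (lcg_inv x) (at level 3, format "x ^-g").
Local Notation "1g" := lcg_one.

(** * Group calculus, compact products and neighbourhoods of the identity *)

Section GroupTheory.
Variable G : lcgroup.
Implicit Types x y z : G.

Lemma lcg_mulKg x y : x^-g *g (x *g y) = y.
Proof. by rewrite lcg_mulA lcg_mulVg lcg_mul1g. Qed.

Lemma lcg_mulVKg x y : x *g (x^-g *g y) = y.
Proof. by rewrite lcg_mulA lcg_mulgV lcg_mul1g. Qed.

Lemma lcg_mulgK x y : y *g x *g x^-g = y.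
Proof. by rewrite -lcg_mulA lcg_mulgV lcg_mulg1. Qed.

Lemma lcg_mulgVK x y : y *g x^-g *g x = y.
Proof. by rewrite -lcg_mulA lcg_mulVg lcg_mulg1. Qed.

Lemma lcg_invK x : x^-g^-g = x.
Proof. by rewrite -[LHS](lcg_mulgVK x) lcg_mulVg lcg_mul1g. Qed.

Lemma lcg_inv1 : (1g : G)^-g = 1g.
Proof. by rewrite -[LHS]lcg_mulg1 lcg_mulVg. Qed.

Lemma lcg_mulgI x : injective (lcg_mul x).
Proof. by move=> y z e; rewrite -(lcg_mulKg x y) e lcg_mulKg. Qed.

Lemma lcg_mulIg x : injective (lcg_mul^~ x).
Proof. by move=> y z /= e; rewrite -(lcg_mulgK x y) e lcg_mulgK. Qed.

Lemma lcg_invM x y : (x *g y)^-g = y^-g *g x^-g.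
Proof.
by apply: (@lcg_mulgI (x *g y)); rewrite lcg_mulgV -lcg_mulA lcg_mulVKg lcg_mulgV.
Qed.

Lemma inv_continuous : continuous (@lcg_inv G).
Proof.
move=> x; have -> : @lcg_inv G = (fun p : G * G => p.1 *g p.2^-g) \o (fun y => (1g, y)).
  by apply/funext => y /=; rewrite lcg_mul1g.
apply: (@continuous_comp G (G * G)%type G (fun y => (1g : G, y))); last exact: lcg_cont.
apply: cvg_pair; [exact: cvg_cst|exact: cvg_id].
Qed.

Lemma mul_continuous : continuous (fun p : G * G => p.1 *g p.2).
Proof.
move=> p; have -> : (fun p : G * G => p.1 *g p.2) =
   (fun p : G * G => p.1 *g p.2^-g) \o (fun p => (p.1, p.2^-g)).
  by apply/funext => q /=; rewrite lcg_invK.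
apply: (@continuous_comp (G * G)%type (G * G)%type G (fun p : G * G => (p.1, p.2^-g)));
  last exact: lcg_cont.
apply: cvg_pair; first exact: cvg_fst.
apply: (@continuous_comp (G * G)%type G G snd); [exact: cvg_snd|exact: inv_continuous].
Qed.

Lemma lmul_continuous x : continuous (lcg_mul x).
Proof.
move=> y; apply: (@continuous_comp G (G * G)%type G (fun y => (x, y)) (fun p => p.1 *g p.2));
  last exact: mul_continuous.
apply: cvg_pair; [exact: cvg_cst|exact: cvg_id].
Qed.

Lemma rmul_continuous x : continuous (lcg_mul^~ x).
Proof.
move=> y; apply: (@continuous_comp G (G * G)%type G (fun y => (y, x)) (fun p => p.1 *g p.2));
  last exact: mul_continuous.
apply: cvg_pair; [exact: cvg_id|exact: cvg_cst].
Qed.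

Lemma image_rmul x (A : set G) : [set a *g x | a in A] = lcg_mul^~ x^-g @^-1` A.
Proof.
apply/seteqP; split => [_ [a Aa <-]|y Ay] /=; first by rewrite lcg_mulgK.
by exists (y *g x^-g) => //; rewrite lcg_mulgVK.
Qed.

Lemma open_rmul x (A : set G) : open A -> open [set a *g x | a in A].
Proof.
by move=> oA; rewrite image_rmul; apply: open_comp => // y _; exact: rmul_continuous.
Qed.

Lemma open_inv (A : set G) : open A -> open (lcg_inv @^-1` A).
Proof. by move=> oA; apply: open_comp => // y _; exact: inv_continuous. Qed.

Lemma compact_image (T U : topologicalType) (f : T -> U) (A : set T) :
  continuous f -> compact A -> compact [set f x | x in A].
Proof. by move=> cf; apply: continuous_compact; exact: continuous_subspaceT. Qed.

Lemma inv_compact (A : set G) : compact A -> compact [set x^-g | x in A].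
Proof. exact: compact_image inv_continuous. Qed.

Lemma setmul_compact (A B : set G) : compact A -> compact B -> compact (setmul A B).
Proof.
move=> cA cB; have -> : setmul A B = [set p.1 *g p.2 | p in A `*` B].
  apply/seteqP; split => [_ [a Aa] [b Bb] <-|_ [[a b] [/= Aa Bb] <-]].
    by exists (a, b).
  by exists a => //; exists b.
exact/(compact_image mul_continuous)/compact_setX.
Qed.

(** A tube lemma: compactness of [K], in its near-covering form, is applied to the neighbourhood
    filter of [1g]. *)
Lemma compact_mul_nbhs (K U : set G) : compact K -> open U -> K `<=` U ->
  exists V : set G, [/\ open V, V 1g & setmul K V `<=` U].
Proof.
move=> /compact_near_coveringP cK oU KU.
have : nbhs (1g : G) [set v | K `<=` (fun x => U (x *g v))].
  apply: (cK G (nbhs (1g : G)) (fun v x => U (x *g v))) => x Kx.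
  have : nbhs (x, 1g : G) ((fun p : G * G => p.1 *g p.2) @^-1` U).
    apply: mul_continuous; apply: open_nbhs_nbhs; split => //=.
    by rewrite lcg_mulg1; exact: KU.
  exact.
rewrite nbhsE => -[V [oV V1] KV].
exists V; split => // _ [x Kx] [v Vv <-]; exact: KV.
Qed.

Lemma mul_compact_nbhs (K U : set G) : compact K -> open U -> K `<=` U ->
  exists V : set G, [/\ open V, V 1g & setmul V K `<=` U].
Proof.
move=> cK oU KU.
have [||x /= Kx|V [oV V1 KV]] := @compact_mul_nbhs (lcg_inv @` K) (lcg_inv @^-1` U).
- exact: inv_compact.
- exact: open_inv.
- by case: Kx => y Ky <-; rewrite lcg_invK; exact: KU.
exists (lcg_inv @^-1` V); split; [exact: open_inv|by rewrite /= lcg_inv1|].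
move=> _ [v Vv] [x Kx <-]; rewrite -[_ *g _]lcg_invK lcg_invM.
by apply: KV; exists x^-g; [exists x|exists v^-g].
Qed.

Lemma nbhs1_sqr (U : set G) : open U -> U 1g ->
  exists V : set G, [/\ open V, V 1g & setmul V V `<=` U].
Proof.
move=> oU U1; have : nbhs (1g : G, 1g : G) ((fun p : G * G => p.1 *g p.2) @^-1` U).
  by apply: mul_continuous; apply: open_nbhs_nbhs; split => //=; rewrite lcg_mulg1.
move=> [[A B] /=]; rewrite !nbhsE => -[[A' [oA A1] AA] [B' [oB B1] BB]] AB.
exists (A' `&` B'); split; [exact: openI|by []|].
by move=> _ [x [Ax _]] [y [_ By] <-]; apply: (AB (x, y)); split; [exact: AA|exact: BB].
Qed.

Lemma nbhs1_divr (U : set G) : open U -> U 1g ->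
  exists V : set G, [/\ open V, V 1g & forall x y, V x -> V y -> U (x *g y^-g)].
Proof.
move=> oU /(nbhs1_sqr oU)[V [oV V1 VV]].
exists (V `&` lcg_inv @^-1` V); split; [|by split; rewrite //= lcg_inv1|].
  exact/(openI oV)/open_inv.
by move=> x y [Vx _] [_ Vy]; apply: VV; exists x => //; exists y^-g.
Qed.

Lemma compact_nbhs1 : exists K U : set G, [/\ compact K, open U, U 1g & U `<=` K].
Proof.
have [K []] := lcg_loc_compact (1g : G); rewrite nbhsE => -[U [oU U1] UK] cK.
by exists K, U.
Qed.

Lemma lcg_compact_closed (K : set G) : compact K -> closed K.
Proof. apply: compact_closed; exact: lcg_hausdorff. Qed.

(** Centres can be taken in a dense [D] because [V^-1 y] is open and meets [D] for every [y] in [K].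
    Keeping each centre within [V] of [K] later confines the lattice points chosen as centres. *)
Lemma compact_cover_translates (V K D : set G) : open V -> V 1g -> compact K ->
  (forall U, open U -> U !=set0 -> U `&` D !=set0) ->
  exists s : seq G, [/\ uniq s,
    forall x, x \in s -> D x /\ (exists2 y, K y & V (y *g x^-g)) &
    forall y, K y -> exists2 x, x \in s & V (y *g x^-g)].
Proof.
move=> oV V1 cK dD.
(* Covering compactness is used over a pointed space, so [G] is repackaged with base point [1g]. *)
pose G' : ptopologicalType := HB.pack (Topological.sort G)
  (Topological.class (lcg_sort G)) (isPointed.Build (Topological.sort G) 1g).
have {}cK : @cover_compact G' K by rewrite -compact_cover.
pose D' := D `&` [set x | exists2 y, K y & V (y *g x^-g)].
have [x _|y Ky|s sD sK] := cK G D' (fun x => [set v *g x | v in V]).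
- exact: open_rmul.
- have [||_ [[v Vv <-] Dv]] := dD [set v *g y | v in lcg_inv @^-1` V].
  + exact/open_rmul/open_inv.
  + by exists (1g *g y); exists 1g => //=; rewrite lcg_inv1.
  + exists (v *g y); last by exists v^-g => //; rewrite lcg_mulKg.
    by split => //; exists y => //; rewrite lcg_invM lcg_mulVKg.
exists (finmap.enum_fset s); split; first exact: finmap.fset_uniq.
  by move=> x xs; have := sD x xs; rewrite inE.
by move=> y /sK[x /= xs [v Vv <-]]; exists x => //; rewrite lcg_mulgK.
Qed.

End GroupTheory.

(** * Borel sets and finite additivity of Haar measure *)

Section HaarTheory.
Variables (R : realType) (G : lcgroup) (mu : set G -> \bar R).
Local Open Scope ereal_scope.

Lemma Borel_open (A : set G) : open A -> Borel A.
Proof. by move=> oA; exact: sub_sigma_algebra. Qed.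

Lemma Borel0 : Borel (set0 : set G).
Proof. exact: sigma_algebra0. Qed.

Lemma BorelC (A : set G) : Borel A -> Borel (~` A).
Proof. by move=> bA; rewrite -setTD; exact: sigma_algebraCD. Qed.

Lemma BorelU (A B : set G) : Borel A -> Borel B -> Borel (A `|` B).
Proof.
move=> bA bB; rewrite -bigcup2E; apply: sigma_algebra_bigcup.
by case=> [|[|n]] //=; exact: Borel0.
Qed.

Lemma BorelI (A B : set G) : Borel A -> Borel B -> Borel (A `&` B).
Proof.
move=> bA bB; rewrite -(setCK (A `&` B)) setCI.
by apply: BorelC; apply: BorelU; exact: BorelC.
Qed.

Lemma BorelD (A B : set G) : Borel A -> Borel B -> Borel (A `\` B).
Proof. by move=> bA bB; rewrite setDE; apply: BorelI => //; exact: BorelC. Qed.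

Lemma Borel_closed (A : set G) : closed A -> Borel A.
Proof.
move=> cA; rewrite -(setCK A).
by apply: BorelC; apply: Borel_open; exact: closed_openC.
Qed.

Lemma Borel_compact (A : set G) : compact A -> Borel A.
Proof. by move=> cA; apply: Borel_closed; exact: lcg_compact_closed. Qed.

Hypothesis haar : left_haar mu.

Lemma haar_ge0 (A : set G) : Borel A -> 0 <= mu A.
Proof. by case: haar => _ [+ _]; apply. Qed.

Lemma haarU (A B : set G) : Borel A -> Borel B -> A `&` B = set0 ->
  mu (A `|` B) = mu A + mu B.
Proof.
case: haar => mu0 [mu_ge0 [sadd _]] bA bB AB0.
have bb n : Borel (bigcup2 A B n).
  by case: n => [|[|n]] //=; exact: Borel0.
have := sadd (bigcup2 A B) bb; rewrite -trivIset_bigcup2 bigcup2E => /(_ AB0) h.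
(* The sequence is [A], [B], then empty sets, so partial sums are constant from index 2 on. *)
have h' : (fun n => \sum_(k < n) mu (bigcup2 A B k)) @ \oo --> mu A + mu B.
  rewrite -(cvg_shiftn 2) /=; apply: cvg_near_cst; apply: nearW => n.
  by rewrite addn2 !big_ord_recl /= big1 ?adde0// => i _; exact: mu0.
exact: (cvg_unique _ h h').
Qed.

Lemma haar_split (A B : set G) : Borel A -> Borel B ->
  mu A = mu (A `&` B) + mu (A `\` B).
Proof.
move=> bA bB; rewrite -haarU; first by rewrite setUIDK.
- exact: BorelI.
- exact: BorelD.
- by apply/seteqP; split => // x [[_ Bx] [_]].
Qed.

Lemma haar_mono (A B : set G) : Borel A -> Borel B -> A `<=` B -> mu A <= mu B.
Proof.
move=> bA bB AB; rewrite (haar_split bB bA) (setIidr AB).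
by rewrite leeDl// haar_ge0//; exact: BorelD.
Qed.

(** Induction removes one piece from [Y] at a time. Disjointness is phrased as equality of indices
    of meeting pieces, the form in which separation of a model set supplies it. *)
Lemma haar_sum_disjoint_le (I : eqType) (s : seq I) (F : I -> set G) (Y : set G) :
  uniq s -> Borel Y -> (forall i, i \in s -> Borel (F i)) ->
  (forall i j, i \in s -> j \in s -> F i `&` F j !=set0 -> i = j) ->
  (forall i, i \in s -> F i `<=` Y) -> \sum_(i <- s) mu (F i) <= mu Y.
Proof.
elim: s Y => [|i s IH] Y /=; first by rewrite big_nil => _ bY *; exact: haar_ge0.
move=> /andP[ins us] bY bF dF FY; have bi := bF i (mem_head _ _).
rewrite big_cons (haar_split bY bi) (setIidr (FY i (mem_head _ _))) leeD2l//.
apply: IH => //; first exact: BorelD.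
- by move=> j js; apply: bF; rewrite inE js orbT.
- by move=> j k js ks; apply: dF; rewrite inE ?js ?ks orbT.
move=> j js x Fjx; split; first by apply: (FY j) => //; rewrite inE js orbT.
move=> Fix; move: ins; rewrite (_ : i = j) ?js//.
by apply: dF; [exact: mem_head|rewrite inE js orbT|exists x].
Qed.

(* The weights are the measures of the pieces of [Y] obtained by making the cover
   disjoint. *)
Lemma haar_cover_weights (I : eqType) (s : seq I) (F : I -> set G) (Y : set G) :
  uniq s -> Borel Y -> mu Y < +oo -> (forall i, i \in s -> Borel (F i)) ->
  (forall x, Y x -> exists2 i, i \in s & F i x) ->
  exists a : I -> R,
    [/\ mu Y = \sum_(i <- s) (a i)%:E, forall i, i \in s -> (0 <= a i)%R &
      forall (P : pred I) (Z : set G), Borel Z ->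
        (forall i, i \in s -> P i -> F i `<=` Z) ->
        \sum_(i <- s | P i) (a i)%:E <= mu (Y `&` Z)].
Proof.
elim: s Y => [|i s IH] Y /=.
  move=> _ bY _ _ Y0; have {Y0}-> : Y = set0.
    by apply/seteqP; split => // x /Y0[].
  exists (fun=> 0%R); split => //; first by rewrite big_nil; case: haar.
  by move=> P Z _ _; rewrite big_nil set0I; case: haar => ->.
move=> /andP[ins us] bY finY bF cF; have bi := bF i (mem_head _ _).
have bYi : Borel (Y `\` F i) by exact: BorelD.
have bIi : Borel (Y `&` F i) by exact: BorelI.
have fin A : Borel A -> A `<=` Y -> mu A \is a fin_num.
  move=> bA AY; rewrite ge0_fin_numE ?haar_ge0//.
  by apply: le_lt_trans finY; exact: haar_mono.
have [||x [Yx nFx]|a [aY a0 aP]] := IH (Y `\` F i) us bYi.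
- by rewrite -ge0_fin_numE ?haar_ge0// fin//; exact: subDsetl.
- by move=> j js; apply: bF; rewrite inE js orbT.
- have [j] := cF x Yx; rewrite inE => /orP[/eqP-> //|js Fjx]; by exists j.
(* The head receives the part of [Y] that it covers; the tail keeps its weights for [Y] without
   [F i]. *)
pose b j := if j == i then fine (mu (Y `&` F i)) else a j.
have bi_E : (b i)%:E = mu (Y `&` F i).
  by rewrite /b eqxx fineK// fin//; exact: subIsetl.
have bE j : j \in s -> b j = a j.
  by rewrite /b; case: eqP => // -> is_; rewrite is_ in ins.
have bsum (P : pred I) : \sum_(j <- s | P j) (b j)%:E = \sum_(j <- s | P j) (a j)%:E.
  rewrite big_seq_cond [RHS]big_seq_cond.
  by apply: eq_bigr => j /andP[js _]; rewrite bE.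
exists b; split.
- by rewrite big_cons bi_E bsum -aY -haar_split.
- move=> j; rewrite inE => /orP[/eqP->|js]; last by rewrite bE ?a0.
  by rewrite -lee_fin bi_E haar_ge0.
move=> P Z bZ PZ.
have IHZ : \sum_(j <- s | P j) (b j)%:E <= mu ((Y `&` Z) `\` F i).
  rewrite bsum -setIDA -setIDAC; apply: aP => // j js; apply: PZ; by rewrite inE js orbT.
rewrite big_cons; case: ifPn => Pi.
  rewrite bi_E (haar_split (BorelI bY bZ) bi) leeD//.
  by rewrite -setIA (setIidr (PZ i (mem_head _ _) Pi)).
apply: le_trans IHZ _; apply: haar_mono.
- by apply: BorelD => //; exact: BorelI.
- exact: BorelI.
- exact: subDsetl.
Qed.

End HaarTheory.

(** * Lattice points, model sets and their upper Leptin density *)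

Section CutAndProject.
Variables (R : realType) (G H : lcgroup).
Variables (mG : set G -> \bar R) (mH : set H -> \bar R) (L : set (G * H)).

(** Finitely many products of small translates cover [A] times [B]. Each holds at most one lattice
    point, since the quotient of two of them falls in a neighbourhood meeting [L] only in the
    identity. *)
Lemma uniform_lattice_finite (A : set G) (B : set H) :
  uniform_lattice L -> compact A -> compact B -> finite_set (L `&` A `*` B).
Proof.
case=> -[L1 LM LV] _ dL _ cA cB.
have [U [[[A0 B0] /= []]]] := dL _ L1; rewrite !nbhsE.
move=> [A1 [oA1 A11] A10] [B1 [oB1 B11] B10] AB0 UL.
have [V [oV V1 VA]] := nbhs1_divr oA1 A11.
have [V' [oV' V'1 VB]] := nbhs1_divr oB1 B11.
have setT_dense (T : lcgroup) (O : set T) : open O -> O !=set0 -> O `&` setT !=set0.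
  by rewrite setIT.
have [s [_ _ sA]] := compact_cover_translates oV V1 cA (@setT_dense G).
have [s' [_ _ sB]] := compact_cover_translates oV' V'1 cB (@setT_dense H).
pose F (z : G * H) := L `&` [set p | V (p.1 *g z.1^-g) /\ V' (p.2 *g z.2^-g)].
have F1 z p q : F z p -> F z q -> p = q.
  move=> [Lp [Vp V'p]] [Lq [Vq V'q]].
  have : (U `&` L) (pmul p (Defs.pinv q)).
    split; last exact/LM/LV.
    apply: AB0; split => /=; [apply: A10|apply: B10].
      by move: (VA _ _ Vp Vq); rewrite lcg_invM lcg_invK lcg_mulA lcg_mulgVK.
    by move: (VB _ _ V'p V'q); rewrite lcg_invM lcg_invK lcg_mulA lcg_mulgVK.
  rewrite UL => -[]; rewrite -(lcg_mulgV q.1) -(lcg_mulgV q.2).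
  move=> /lcg_mulIg e1 /lcg_mulIg e2.
  by rewrite (surjective_pairing p) e1 e2 -surjective_pairing.
apply: (@sub_finite_set _ _ (\bigcup_(z in [set` s] `*` [set` s']) F z)).
  move=> p [Lp [/sA[x xs Vx] /sB[y ys Vy]]].
  by exists (x, y).
apply: bigcup_finite; first by apply: finite_setX; exact: finite_seq.
move=> z _; have [[p Fp]|F0] := pselect (exists p, F z p).
  by apply: (@sub_finite_set _ _ [set p]) => [q /F1 -/(_ p Fp)->//|]; exact: finite_set1.
by apply: (@sub_finite_set _ _ set0) => // q Fq; case: F0; exists q.
Qed.

Lemma model_set_finite (A : set G) (O : set H) :
  uniform_lattice L -> compact A -> (exists2 C, compact C & O `<=` C) ->
  finite_set (model_set L O `&` A).
Proof.
move=> uL cA [C cC OC].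
apply: sub_finite_set (finite_image fst (uniform_lattice_finite uL cA cC)).
move=> _ [[p [Lp Op] <-] Ap]; exists p => //; split => //; split => //; exact: OC.
Qed.

Hypothesis cp : cut_and_project mG mH L.

(* Only finitely many lattice points lie over a compact set of differences, so a
   small neighbourhood of the identity avoids all of their first coordinates. *)
Lemma model_set_separated (B : set H) : compact B ->
  exists E K : set G, [/\ open E, E 1g, compact K, E `<=` K &
    forall x y, model_set L B x -> model_set L B y ->
      [set e *g x | e in E] `&` [set e *g y | e in E] !=set0 -> x = y].
Proof.
move=> cB; have [_ _ uL injL _] := cp; have [[L1 LM LV] _ _ _] := uL.
have [K [U [cK oU U1 UK]]] := compact_nbhs1 G.
pose P := [set p.1 | p in L `&` K `*` setmul B (lcg_inv @` B)] `\` [set 1g : G].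
have oP : open (~` P).
  apply: closed_openC.
  have : accessible_space G by apply: hausdorff_accessible; exact: lcg_hausdorff.
  move=> /accessible_finite_set_closed; apply.
  apply: finite_setD; apply: finite_image; apply: uniform_lattice_finite => //.
  by apply: setmul_compact => //; exact: inv_compact.
have [|V [oV V1 VV]] := nbhs1_divr (openI oU oP).
  by split => // -[_]; apply.
exists ((lcg_inv @^-1` V) `&` U), K; split => //.
- by apply: openI => //; exact: open_inv.
- by split => //=; rewrite lcg_inv1.
- by move=> x [_ /UK].
move=> _ _ [p [Lp Bp] <-] [q [Lq Bq] <-].
move=> [z [[e [Ve Ue] <-] [e' [Ve' Ue'] ee']]].
(* A common point of the two translates exhibits the difference as an element of [U] outside [P].
   Since it also comes from a lattice point over [B B^-1], it can only be trivial. *)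
have eq : e'^-g *g e = q.1 *g p.1^-g.
  by apply: (@lcg_mulIg _ p.1); rewrite lcg_mulgVK -lcg_mulA -ee' lcg_mulKg.
have := VV _ _ Ve' Ve; rewrite lcg_invK eq => -[/UK Kqp nP].
apply: contrapT => npq; apply: nP; split.
  exists (pmul q (Defs.pinv p)) => //; split; first exact/LM/LV.
  by split => //=; exists q.2 => //; exists p.2^-g => //; exists p.2.
by move=> /=; rewrite -(lcg_mulgV p.1) => /lcg_mulIg e1; apply: npq.
Qed.

(** The constant is [1 / (mH N * mG E)], where [N] is a compact neighbourhood of the identity and
    [E] separates a model set. It depends on [C] alone, so [O'] may be chosen afterwards. The bound
    comes from double counting the pairs of a point of the model set and a weighted translation. *)
Lemma upper_leptin_model_set_le (C : set H) : compact C ->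
  exists2 c : R, 0 < c & forall (O O' V : set H) (d : R), O `<=` C ->
    open V -> V 1g -> open O' -> setmul V O `<=` O' -> (mH O' <= d%:E)%E ->
    (upper_leptin mG (model_set L O) <= (c * d)%:E)%E.
Proof.
move=> cC; have [[lG rG] [lH rH] uL injL dL] := cp.
have [[L1 LM LV] _ _ _] := uL.
have [N [UN [cN oUN UN1 UNN]]] := compact_nbhs1 H.
(* A centre [i] has [y] in [N] and [y i^-1] in [N] for some [y], hence [i^-1] in [N^-1 N]; so [B]
   receives all points [i^-1 o] with [o] in [C]. *)
pose B := setmul (setmul (lcg_inv @` N) N) C.
have cB : compact B.
  apply: setmul_compact => //; apply: setmul_compact => //.
  by exact: inv_compact.
have [E [K [oE E1 cK EK Esep]]] := model_set_separated cB.
have haar_fin (T : lcgroup) (mu : set T -> \bar R) (A D : set T) : left_haar mu ->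
    Borel A -> Borel D -> compact D -> A `<=` D -> mu A \is a fin_num.
  move=> h bA bD cD AD; rewrite ge0_fin_numE ?(haar_ge0 h)//.
  apply: le_lt_trans (haar_mono h bA bD AD) _.
  by case: h => _ [_ [_ [_ [+ _]]]]; apply.
have haar_pos (T : lcgroup) (mu : set T -> \bar R) (A : set T) : left_haar mu ->
    open A -> A !=set0 -> (0 < mu A)%E.
  by move=> [_ [_ [_ [_ [_ [+ _]]]]]]; apply.
have bN : Borel N by exact: Borel_compact.
have bE : Borel E by exact: Borel_open.
have fN : mH N \is a fin_num by exact: (haar_fin _ _ _ N).
have fE : mG E \is a fin_num by apply: (haar_fin _ _ _ K) => //; exact: Borel_compact.
have pE : 0 < fine (mG E).
  by rewrite -lte_fin fineK//; apply: haar_pos => //; exists 1g.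
have pN : 0 < fine (mH N).
  rewrite -lte_fin fineK//; apply: lt_le_trans (haar_mono lH _ bN UNN); last exact: Borel_open.
  by apply: haar_pos => //; exists 1g.
exists (fine (mH N) * fine (mG E))^-1; first by rewrite invr_gt0 mulr_gt0.
move=> O O' V d OC oV V1 oO' VO dO'.
pose V1' := V `&` UN.
have oV1 : open V1' by exact: openI.
have [s [us sP sN]] : exists s : seq H, [/\ uniq s,
    forall x, x \in s -> [set p.2 | p in L] x /\ (exists2 y, N y & V1' (y *g x^-g)) &
    forall y, N y -> exists2 x, x \in s & V1' (y *g x^-g)].
  by apply: compact_cover_translates => // U oU U0; exact: dL.
(* [f] lifts each centre to a lattice point above it; the value [(1g, 1g)] outside [s] is a
   dummy. *)
have /choice[f fP] : forall x : H, exists p, x \in s -> L p /\ p.2 = x.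
  move=> x; have [/sP[[p Lp px] _]|_] := boolP (x \in s); first by exists p.
  by exists (1g, 1g).
pose F (x : H) := [set v *g x | v in V1'].
have bF x : x \in s -> Borel (F x) by move=> _; apply: Borel_open; exact: open_rmul.
have [|x Nx|a [aN a0 aP]] := haar_cover_weights lH us bN _ bF.
- by rewrite -ge0_fin_numE// haar_ge0.
- by have [y ys Vy] := sN x Nx; exists y => //; exists (x *g y^-g) => //; rewrite lcg_mulgVK.
(* The compact set tested in the infimum: it makes [setmul K' A] contain every [E m] packed
   below. *)
pose K' := setmul K [set (f x).1^-g | x in [set` s]].
have cK' : compact K'.
  apply: setmul_compact => //; apply: finite_compact.
  by apply: finite_image; exact: finite_seq.
have K'0 : K' !=set0.
  have [x xs _] := sN 1g (UNN _ UN1).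
  exists (1g *g (f x).1^-g); exists 1g; first exact: EK.
  by exists (f x).1^-g => //; exists x.
apply: le_trans (ereal_inf_lbound _) _; first by exists K'.
apply: ge_ereal_sup => _ [A [cA [A0 mA0]] <-].
have cKA : compact (setmul K' A) by exact: setmul_compact.
have bKA := Borel_compact cKA.
have finX := model_set_finite uL cA (ex_intro2 _ _ _ cC OC).
rewrite /counting asboolT//.
set xs := finmap.enum_fset _.
have xsP x : (x \in xs) -> model_set L O x /\ A x.
  by rewrite /xs in_fset_set// inE.
have uxs : uniq xs by exact: finmap.fset_uniq.
(* All translates of the counted points, without repetition; they lie in the model set of [B]. *)
pose S := undup [seq (f i).1^-g *g x | x <- xs, i <- s].
have Sfac m : m \in S -> exists2 i, i \in s & exists2 x, x \in xs & m = (f i).1^-g *g x.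
  rewrite mem_undup => /allpairsP[[x i] /= [xxs is_ ->]].
  by exists i => //; exists x.
have SB m : m \in S -> exists p, [/\ L p, p.1 = m & B p.2].
  move=> /Sfac[i is_ [x /xsP[[q [Lq Oq] <-] _] ->]].
  have [Lf fi] := fP i is_; exists (pmul (Defs.pinv (f i)) q); split => //.
    by apply: LM => //; exact: LV.
  have [_ [y Ny [_ UNy]]] := sP i is_.
  exists i^-g; last by exists q.2; [exact: OC|rewrite /= fi].
  exists y^-g; first by exists y.
  by exists (y *g i^-g); [exact: UNN|rewrite lcg_mulKg].
have mapsK m e : m \in S -> K e -> setmul K' A (e *g m).
  move=> /Sfac[i is_ [x /xsP[_ Ax] ->]] Ke; rewrite lcg_mulA.
  exists (e *g (f i).1^-g); last by exists x.
  by exists e => //; exists (f i).1^-g => //; exists i.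
(* Packing: the sets [E m] are disjoint inside [setmul K' A], and right invariance gives them equal
   measure. *)
have leS : (((size S)%:R * fine (mG E))%:E <= mG (setmul K' A))%E.
  have -> : ((size S)%:R * fine (mG E))%:E =
      (\sum_(m <- S) mG [set e *g m | e in E])%E.
    under eq_bigr => m _ do rewrite rG// -(fineK fE).
    by rewrite sumEFin big_const_seq count_predT iter_addr_0 mulr_natl.
  apply: (haar_sum_disjoint_le lG) => //; first exact: undup_uniq.
  - by move=> m _; apply: Borel_open; exact: open_rmul.
  - move=> m m' /SB[p [Lp <- Bp]] /SB[q [Lq <- Bq]]; apply: Esep.
      by exists p.
    by exists q.
  - by move=> m mS _ [e /EK Ke <-]; exact: mapsK.
(* Let [p] be the lattice point over [m]. By injectivity on [L], each counted [i] has [i p.2] in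
   [O], so its covering piece lies in [O' p.2^-1], which has the measure of [O'] by right
   invariance. *)
have leP m : m \in S -> \sum_(i <- s | (f i).1 *g m \in xs) a i <= d.
  move=> /SB[p [Lp <- Bp]]; rewrite -lee_fin -sumEFin; apply: le_trans dO'.
  have bO' : Borel [set o *g p.2^-g | o in O'].
    by apply: Borel_open; exact: open_rmul.
  rewrite -(rH p.2^-g O'); last exact: Borel_open.
  apply: le_trans (haar_mono lH _ bO' (@subIsetr _ N _)); last exact: BorelI.
  apply: aP => // i is_ /xsP[[q [Lq Oq] qE] _] _ [v [Vv _] <-].
  have [Lf fi] := fP i is_.
  have eq : q = pmul (f i) p by apply: injL; rewrite ?inE//; exact: LM.
  exists (v *g (i *g p.2)); last by rewrite -!lcg_mulA lcg_mulgV lcg_mulg1.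
  apply: VO; exists v => //; exists (i *g p.2) => //.
  by move: Oq; rewrite eq /= fi.
(* Double counting: each [i] contributes [a i] once per point of [xs], through the injective map [x]
   to [(f i).1^-1 x] into [S]; summing over [m] first gives at most [d] each. *)
have leX : (size xs)%:R * fine (mH N) <= (size S)%:R * d.
  rewrite aN sumEFin /= mulr_sumr.
  apply: (@le_trans _ _ (\sum_(m <- S) \sum_(i <- s | (f i).1 *g m \in xs) a i)); last first.
    apply: (@le_trans _ _ (\sum_(m <- S) d)).
      by rewrite big_seq [leRHS]big_seq; exact: ler_sum.
    by rewrite big_const_seq count_predT iter_addr_0 mulr_natl.
  under [leRHS]eq_bigr => m _ do rewrite big_mkcond.
  rewrite exchange_big /= big_seq [leRHS]big_seq; apply: ler_sum => i is_.
  rewrite -big_mkcond /= big_const_seq iter_addr_0 -[leRHS]mulr_natl.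
  rewrite ler_wpM2r ?a0// ler_nat -size_filter -(size_map (fun x => (f i).1^-g *g x) xs).
  apply: uniq_leq_size => [|_ /mapP[x xxs ->]].
    by rewrite map_inj_uniq//; exact: lcg_mulgI.
  rewrite mem_filter lcg_mulVKg xxs mem_undup; exact: allpairs_f.
have [k K'k] := K'0.
have bA := Borel_compact cA.
(* [setmul K' A] contains the left translate [k A], of positive measure. *)
have pM : (0 < mG (setmul K' A))%E.
  apply: lt_le_trans mA0 _.
  have [_ [_ [_ [lI _]]]] := lG; rewrite -(lI k)//; apply: (haar_mono lG) => //.
    by apply: Borel_compact; apply: compact_image cA; exact: lmul_continuous.
  by move=> _ [x Ax <-]; exists k => //; exists x.
have fM : mG (setmul K' A) \is a fin_num by exact: (haar_fin _ _ _ (setmul K' A)).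
move: leS pM; rewrite -(fineK fM) lee_fin lte_fin => leS pM.
rewrite inver gt_eqF// lee_pdivrMr// -EFinM lee_fin.
rewrite -(mulrA _ d) mulrC ler_pdivlMr ?mulr_gt0//.
have d0 : 0 <= d by rewrite -lee_fin (le_trans _ dO')// haar_ge0//; exact: Borel_open.
rewrite mulrA (le_trans (ler_wpM2r (ltW pE) leX))//.
by rewrite mulrAC mulrC ler_wpM2l.
Qed.

(** Writing [(g, 1g)] as [k l] forces [k.2] to be the inverse of [l.2]. Multiplying [l] on the left
    by one of finitely many lattice points brings its [H]-component into [U], and the inverse
    correction is absorbed into the compact set. *)
Lemma model_set_right_rel_dense (U : set H) : open U -> U 1g ->
  right_rel_dense (model_set L U).
Proof.
move=> oU U1; have [_ _ [[_ LM _] _ _ [K [cK KL]]] _ dL] := cp.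
have cK2 : compact (snd @` K) by apply: compact_image cK => p; exact: cvg_snd.
have [||s [_ sP sK]] := compact_cover_translates (open_inv oU) _ cK2
  (D := [set p.2 | p in L]).
- by rewrite /= lcg_inv1.
- by move=> O oO O0; exact: dL.
have /choice[f fP] : forall x : H, exists p, x \in s -> L p /\ p.2 = x.
  move=> x; have [/sP[[p Lp px] _]|_] := boolP (x \in s); first by exists p.
  by exists (1g, 1g).
exists (setmul (fst @` K) [set (f x).1^-g | x in [set` s]]); split.
  apply: setmul_compact; first by apply: compact_image cK => p; exact: cvg_fst.
  by apply: finite_compact; apply: finite_image; exact: finite_seq.
apply/seteqP; split => // g _.
have [k [l [Kk Ll [gE /esym kl1]]]] := KL (g, 1g).
have [|x xs] := sK k.2; first by exists k.
have [Lf fx] := fP x xs.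
have -> : k.2 = l.2^-g by apply: (@lcg_mulIg _ l.2); rewrite kl1 lcg_mulVg.
rewrite /= lcg_invM !lcg_invK => Uxl.
exists (k.1 *g (f x).1^-g).
  by exists k.1; [exists k|exists (f x).1^-g => //; exists x].
exists ((f x).1 *g l.1); last by rewrite gE lcg_mulA lcg_mulgVK.
by exists (pmul (f x) l) => //; split; [exact: LM|rewrite /= fx].
Qed.

(** Inversion turns the model set of [U^-1] into that of [U] and exchanges the two sides. *)
Lemma model_set_left_rel_dense (U : set H) : open U -> U 1g ->
  left_rel_dense (model_set L U).
Proof.
move=> oU U1; have [_ _ [[_ _ LV] _ _ _] _ _] := cp.
have [|K [cK KT]] := model_set_right_rel_dense (open_inv oU).
  by rewrite /= lcg_inv1.
exists (lcg_inv @` K); split; first exact: inv_compact.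
apply/seteqP; split => // g _.
have [k Kk [_ [p [Lp Up] <-] kpg]] : setmul K (model_set L (lcg_inv @^-1` U)) g^-g.
  by rewrite KT.
exists p.1^-g; first by exists (Defs.pinv p) => //; split => //; exact: LV.
by exists k^-g; [exists k|rewrite -lcg_invM kpg lcg_invK].
Qed.

(** Injectivity of the first projection on [L] lets both memberships be read off from one lattice
    point. *)
Lemma symdiff_model_set (W : set H) (p : G * H) : L p ->
  symdiff (model_set L W) [set x *g p.1 | x in model_set L W] =
  model_set L (symdiff W [set w *g p.2 | w in W]).
Proof.
move=> Lp; have [_ _ [[_ LM LV] _ _ _] injL _] := cp.
have inj q r : L q -> L r -> q.1 = r.1 -> q = r.
  by move=> Lq Lr; apply: injL; rewrite inE.
have Lpq q : L q -> L (pmul q (Defs.pinv p)) by move=> Lq; apply/LM/LV.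
apply/seteqP; split => [x [[[q [Lq Wq] <-] nx]|[[_ [q [Lq Wq] <-] <-] nx]]|
    _ [q [Lq [[Wq nq]|[[w Ww wq] nq]]] <-]].
- exists q => //; split => //; left; split => // -[w Ww wq]; apply: nx.
  exists (q.1 *g p.1^-g); last by rewrite lcg_mulgVK.
  exists (pmul q (Defs.pinv p)) => //; split; first exact: Lpq.
  by rewrite /= -wq lcg_mulgK.
- exists (pmul q p) => //; split; first exact: LM.
  right; split; first by exists q.2.
  by move=> /= Wqp; apply: nx; exists (pmul q p) => //; split => //; exact: LM.
- left; split; first by exists q.
  move=> [_ [r [Lr Wr] <-] rq]; apply: nq; exists r.2 => //.
  by rewrite (inj q (pmul r p))//; exact: LM.
right; split; last by move=> [r [Lr Wr] rq]; apply: nq; rewrite (inj q r).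
exists (q.1 *g p.1^-g); last by rewrite lcg_mulgVK.
exists (pmul q (Defs.pinv p)) => //; split; first exact: Lpq.
by rewrite /= -wq lcg_mulgK.
Qed.

End CutAndProject.

(** * Small translations of the window, and the conclusion *)

Lemma closed_topboundary (T : topologicalType) (W : set T) : closed (topboundary W).
Proof. by apply: closedI; exact: closed_closure. Qed.

(** A point of [closure W] away from the boundary is interior, and by compactness stays so under
    uniformly small translations; hence [W] and [W u] can differ only near the boundary. *)
Lemma symdiff_translate_near_boundary (H : lcgroup) (W O : set H) :
  compact (closure W) -> open O -> topboundary W `<=` O ->
  exists V U : set H, [/\ open V, V 1g, open U, U 1g &
    forall u, U u -> setmul V (symdiff W [set w *g u | w in W]) `<=` O].
Proof.
move=> cW oO DO; set D := topboundary W in DO.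
have cD : compact D.
  apply: (subclosed_compact _ cW); last by move=> x [].
  exact: closed_topboundary.
have [V' [oV' V'1 V'D]] := mul_compact_nbhs cD oO DO.
have [V [oV V1 VV]] := nbhs1_sqr oV' V'1.
(* Half of the available room around the boundary; the other factor [V] is spent on the final
   thickening. *)
pose O1 := \bigcup_(d in D) [set v *g d | v in V].
have oO1 : open O1 by apply: bigcup_open => d _; exact: open_rmul.
have VO1 : setmul V O1 `<=` O.
  move=> _ [v Vv [_ [d Dd [v' Vv' <-]] <-]]; rewrite lcg_mulA.
  by apply: V'D; exists (v *g v'); [apply: VV; exists v => //; exists v'|exists d].
have WO1 x : closure W x -> ~ O1 x -> interior W x.
  move=> Wx nO; rewrite -[interior W]setCK -closure_setC => nWx; apply: nO.
  by exists x => //; exists 1g => //; rewrite lcg_mul1g.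
(* [U1] controls points of [W] outside [W u], via [u^-1]; [U2] below controls points of [W u]
   outside [W]. *)
have [|||U1 [oU1 U11 WU1]] := @compact_mul_nbhs _ (closure W `\` O1) (interior W).
- apply: (subclosed_compact _ cW); last by move=> x [].
  by apply: closedI; [exact: closed_closure|exact: open_closedC].
- exact: open_interior.
- by move=> x [Wx nx]; exact: WO1.
have [||U2 [oU2 U21 WU2]] := @compact_mul_nbhs _ _ (interior W `|` O1) cW.
- by apply: openU => //; exact: open_interior.
- by move=> x Wx; have [Ox|nOx] := pselect (O1 x); [right|left; exact: WO1].
exists V, ((lcg_inv @^-1` U1) `&` U2); split => //.
- by apply: openI => //; exact: open_inv.
- by split => //=; rewrite lcg_inv1.
move=> u [U1u U2u] _ [v Vv [x xW <-]]; apply: VO1; exists v => //; exists x => //.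
case: xW => [[Wx nx]|[[w Ww <-] nW]].
  apply: contrapT => nO1; apply: nx; exists (x *g u^-g); last by rewrite lcg_mulgVK.
  apply: interior_subset; apply: WU1; exists x; last by exists u^-g.
  by split => //; exact: subset_closure.
have [|/interior_subset//|//] := WU2 (w *g u).
by exists w; [exact: subset_closure|exists u].
Qed.

Theorem theorem8p3 (R : realType) (G H : lcgroup)
    (mG : set G -> \bar R) (mH : set H -> \bar R)
    (L : set (G * H)) (W : set H) :
  cut_and_project mG mH L ->
  regular_window mH W ->
  amenable mG ->
  right_umap mG (model_set L W).
Proof.
move=> cp [cW _ W0] _ eps eps0.
have [_ [[_ [_ [_ [_ [_ [_ [outer _]]]]]]] _] _ _ _] := cp.
have [N [UN [cN oUN UN1 UNN]]] := compact_nbhs1 H.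
(* The compact set [closure W] times [N] contains [W] and all [W u] with [u] in [N], so one [c]
   serves every translation. *)
have [c c0 leptin_le] := upper_leptin_model_set_le cp (setmul_compact cW cN).
have bD : Borel (topboundary W) by apply: Borel_closed; exact: closed_topboundary.
have : (mH (topboundary W) < (eps / c)%:E)%E by rewrite W0 lte_fin divr_gt0.
(* Outer regularity at the null boundary, with target [eps / c] to cancel the packing constant. *)
rewrite outer// => /ereal_inf_lt[_ [Q [oQ DQ] <-] mQ].
have [V [U [oV V1 oU U1 VU]]] := symdiff_translate_near_boundary cW oQ DQ.
have oU' : open (U `&` UN) by exact: openI.
(* [U] keeps the symmetric difference near the boundary, and [UN] keeps it in the compact set fixed
   for [c]. *)
exists (model_set L (U `&` UN)); split.
- exact: (model_set_left_rel_dense cp).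
- exact: (model_set_right_rel_dense cp).
move=> _ [p [Lp [Up UNp]] <-]; rewrite (symdiff_model_set cp)//.
apply: le_trans (leptin_le _ Q V (eps / c) _ oV V1 oQ (VU _ Up) (ltW mQ)) _.
  move=> x [[Wx _]|[[w Ww <-] _]].
    exists x; first exact: subset_closure.
    by exists 1g; [exact: UNN|rewrite lcg_mulg1].
  exists w; first exact: subset_closure.
  by exists p.2 => //; exact: UNN.
by rewrite mulrC divfK// gt_eqF.
Qed.
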